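(* Let $G$ be a graph with vertex set $[n]$. The commutative quotient $\mathcal E_G^{ab}$ of the Fomin–Kirillov algebra $\mathcal E_G$ is isomorphic to the Orlik–Terao algebra $U_G$ (via $x_{ij}\mapsto u_{ij}$).
   Context: The Fomin–Kirillov algebra $\mathcal E_n$ is the quadratic $\mathbf Q$-algebra with generators $x_{ij}=-x_{ji}$ for distinct $i,j\in[n]$, subject to: $x_{ij}^2=0$ for distinct $i,j$; $x_{ij}x_{kl}=x_{kl}x_{ij}$ for distinct $i,j,k,l$; $x_{ij}x_{jk}+x_{jk}x_{ki}+x_{ki}x_{ij}=0$ for distinct $i,j,k$. For a graph $G$ on $[n]$, $\mathcal E_G$ is the subalgebra of $\mathcal E_n$ generated by $x_{ij}$ for edges $\overline{ij}$ of $G$, and $\mathcal E_G^{ab}$ is the quotient of $\mathcal E_G$ by the two-sided ideal generated by all commutators $ab-ba$, $a,b\in\mathcal E_G$ (equivalently by $x_{ij}x_{kl}-x_{kl}x_{ij}$ for edges of $G$). The Orlik–Terao algebra $U_G$ is the commutative $\mathbf Q$-algebra with generators $u_{ij}=-u_{ji}$ for edges $\overline{ij}$ of $G$, subject to: (1) a monomial in the $u_{ij}$ vanishes if it has a repeated variable or its support (the set of edges whose variable occurs) contains a cycle; (2) for every linear dependence $\sum_{p=1}^k c_p(e_{i_p}-e_{j_p})=0$ in $\mathbf R^n$ among vectors indexed by edges $\overline{i_pj_p}$ of $G$, the relation $\sum_{p=1}^k c_p\prod_{q\ne p}u_{i_qj_q}=0$. *)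

(* Defs.v *)
From HB Require Import structures.
From mathcomp Require Import all_boot all_order all_algebra.
Set Implicit Arguments. Unset Strict Implicit. Unset Printing Implicit Defensive.
Import Order.TTheory GRing.Theory Num.Theory.
Local Open Scope ring_scope.

(* Noncommutative polynomial expressions over Q in variables of type V:
   these represent (surjectively) the elements of the free associative
   unital Q-algebra Q<V>. *)
Inductive ncterm (V : Type) : Type :=
| NVar of V
| NConst of rat
| NAdd of ncterm V & ncterm V
| NMul of ncterm V & ncterm V.

Fixpoint ncev (V : Type) (B : algType rat) (x : V -> B) (t : ncterm V) : B :=
  match t with
  | NVar v => x v
  | NConst c => c%:A
  | NAdd s u => ncev x s + ncev x u
  | NMul s u => ncev x s * ncev x u
  end.

Fixpoint term_over (V : Type) (P : V -> bool) (t : ncterm V) : bool :=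
  match t with
  | NVar v => P v
  | NConst _ => true
  | NAdd s u => term_over P s && term_over P u
  | NMul s u => term_over P s && term_over P u
  end.

Definition pair_t (n : nat) := ('I_n * 'I_n)%type.

(* The graph G: a symmetric irreflexive relation on 'I_n; edge predicate. *)
Definition is_edge (n : nat) (e : rel 'I_n) (p : pair_t n) : bool := e p.1 p.2.

(* Fomin--Kirillov relations for an assignment x of the generators in B.
   (The diagonal symbols x_(i,i) are not generators of E_n; we set them to 0,
   which does not change the algebra.) *)
Definition FK_rel (n : nat) (B : algType rat) (x : pair_t n -> B) : Prop :=
  [/\ (forall i : 'I_n, x (i, i) = 0),
      (forall i j : 'I_n, i != j -> x (j, i) = - x (i, j)),
      (forall i j : 'I_n, i != j -> x (i, j) * x (i, j) = 0),
      (forall i j k l : 'I_n, uniq [:: i; j; k; l] ->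
          x (i, j) * x (k, l) = x (k, l) * x (i, j)) &
      (forall i j k : 'I_n, uniq [:: i; j; k] ->
          x (i, j) * x (j, k) + x (j, k) * x (k, i) + x (k, i) * x (i, j) = 0)].

Definition En_eq (n : nat) (s t : ncterm (pair_t n)) : Prop :=
  forall (B : algType rat) (x : pair_t n -> B), FK_rel x -> ncev x s = ncev x t.

Definition comm_sum_ev (n : nat) (B : algType rat) (x : pair_t n -> B)
    (w : seq (ncterm (pair_t n) * ncterm (pair_t n) *
              ncterm (pair_t n) * ncterm (pair_t n))) : B :=
  \sum_(z <- w)
     ncev x z.1.1.1 * (ncev x z.1.1.2 * ncev x z.1.2 - ncev x z.1.2 * ncev x z.1.1.2)
       * ncev x z.2.

(* An element of E_G (given by an expression in the edge generators) maps to
   zero in E_G^ab = E_G / C, where C is the two-sided ideal of E_G generated by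
   all commutators ab - ba with a, b in E_G: its value in E_n is a finite sum of
   elements p (ab - ba) q with p, a, b, q in E_G. *)
Definition zero_in_EGab (n : nat) (e : rel 'I_n) (f : ncterm (pair_t n)) : Prop :=
  exists w : seq (ncterm (pair_t n) * ncterm (pair_t n) *
                  ncterm (pair_t n) * ncterm (pair_t n)),
    all (fun z => [&& term_over (is_edge e) z.1.1.1, term_over (is_edge e) z.1.1.2,
                      term_over (is_edge e) z.1.2 & term_over (is_edge e) z.2]) w /\
    forall (B : algType rat) (x : pair_t n -> B), FK_rel x ->
      ncev x f = comm_sum_ev x w.

Definition uedge (n : nat) (p : pair_t n) : pair_t n :=
  if (p.1 <= p.2)%N then p else (p.2, p.1).

Definition support_has_cycle (n : nat) (s : seq (pair_t n)) : Prop :=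
  exists c : seq 'I_n, [/\ (3 <= size c)%N, uniq c &
     cycle (fun a b => uedge (a, b) \in map (@uedge n) s) c].

Definition OT_rel (n : nat) (e : rel 'I_n) (B : comAlgType rat)
    (u : pair_t n -> B) : Prop :=
  [/\ (forall i j : 'I_n, e i j -> u (j, i) = - u (i, j)),
      (forall s : seq (pair_t n), all (is_edge e) s ->
          ~~ uniq (map (@uedge n) s) \/ support_has_cycle s ->
          \prod_(p <- s) u p = 0) &
      (forall (k : nat) (c : 'I_k -> rat) (p : 'I_k -> pair_t n),
          (forall t, is_edge e (p t)) ->
          \sum_(t < k) c t *: (delta_mx 0 (p t).1 - delta_mx 0 (p t).2
                                : 'rV[rat]_n) = 0 ->
          \sum_(t < k) c t *: \prod_(q < k | q != t) u (p q) = 0)].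

Definition zero_in_UG (n : nat) (e : rel 'I_n) (f : ncterm (pair_t n)) : Prop :=
  forall (B : comAlgType rat) (u : pair_t n -> B), OT_rel e u -> ncev u f = 0.

(* Main.v *)
(* Both algebras are compared through commutative models of the Fomin-Kirillov
   relations.  The cycle relation of E_n, summing over the rotations of a cycle
   the product of all its steps but one, involves only edges of the cycle; it
   therefore holds in E_G^ab, and the linear dependences among the vectors
   e_i - e_j are spanned by cycles, so E_G^ab satisfies the Orlik-Terao relations.

   Conversely a commutator expression vanishes in every commutative algebra with
   elements y_ij satisfying the Fomin-Kirillov relations, and an element f that
   vanishes in all of these lies in the Orlik-Terao ideal.  This is deletion and
   contraction of an edge p: write f = g + x_p h.  The Fomin-Kirillov relations
   for the graph contracted along p lift to dual numbers A[eps] by sending x_p to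
   eps, so h vanishes in all models of the contraction and, by induction, lies in
   its ideal.  A dependence modulo p lifts to a dependence involving p, so x_p h
   is congruent to some g' without p, and induction applies to g + g'. *)
Require Import Defs.
From HB Require Import structures.
From mathcomp Require Import all_boot all_order all_algebra.
From mathcomp Require Import boolp ring.
Set Implicit Arguments. Unset Strict Implicit. Unset Printing Implicit Defensive.
Import GRing.Theory.
Local Open Scope ring_scope.
Local Open Scope quotient_scope.

(** * Dual numbers *)

(* The pair (a, b) stands for a + b eps with eps^2 = 0. *)
Definition dual (A : comAlgType rat) : Type := (A * A)%type.
HB.instance Definition _ (A : comAlgType rat) :=
  GRing.Lmodule.copy (dual A) (A * A)%type.

Definition dual_one (A : comAlgType rat) : dual A := (1, 0).
Definition dual_mul (A : comAlgType rat) (x y : dual A) : dual A :=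
  (x.1 * y.1, x.1 * y.2 + x.2 * y.1).

Fact dual_mulA (A : comAlgType rat) : associative (@dual_mul A).
Proof. by move=> x y z; congr (_, _) => /=; ring. Qed.

Fact dual_mulC (A : comAlgType rat) : commutative (@dual_mul A).
Proof. by move=> x y; congr (_, _) => /=; ring. Qed.

Fact dual_mul1 (A : comAlgType rat) : left_id (@dual_one A) (@dual_mul A).
Proof. by move=> [a b]; congr (_, _) => /=; ring. Qed.

Fact dual_mulDl (A : comAlgType rat) : left_distributive (@dual_mul A) +%R.
Proof. by move=> x y z; congr (_, _) => /=; ring. Qed.

Fact dual_one_neq0 (A : comAlgType rat) : dual_one A != 0.
Proof. by apply/eqP => -[/eqP]; rewrite oner_eq0. Qed.

HB.instance Definition _ (A : comAlgType rat) :=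
  GRing.Zmodule_isComNzRing.Build (dual A) (@dual_mulA A) (@dual_mulC A)
    (@dual_mul1 A) (@dual_mulDl A) (@dual_one_neq0 A).

Fact dual_scaleAl (A : comAlgType rat) (k : rat) (x y : dual A) :
  k *: dual_mul x y = dual_mul (k *: x) y.
Proof.
rewrite -[LHS]/(k *: (x.1 * y.1), k *: (x.1 * y.2 + x.2 * y.1)).
by rewrite scalerDr !scalerAl.
Qed.
HB.instance Definition _ (A : comAlgType rat) :=
  GRing.Lmodule_isLalgebra.Build rat (dual A) (@dual_scaleAl A).
HB.instance Definition _ (A : comAlgType rat) :=
  GRing.Lalgebra_isComAlgebra.Build rat (dual A).

Lemma dualM (A : comAlgType rat) (x y : dual A) :
  x * y = (x.1 * y.1, x.1 * y.2 + x.2 * y.1).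
Proof. by []. Qed.

(** * The cycle relation of the Fomin-Kirillov algebra *)

(** The model sending every generator to 0 detects constant terms: it settles the edgeless case of
    [dep_ideal_complete] and the nontriviality of [EGab]. *)
Lemma FK_zero n : FK_rel (fun _ : pair_t n => 0 : rat^o).
Proof. by split=> *; rewrite ?oppr0 ?mul0r ?addr0. Qed.

Definition steps (T : Type) (x : T) (s : seq T) : seq (T * T) := pairmap pair x s.

Lemma steps_rcons (T : Type) (x : T) (s : seq T) (z : T) :
  steps x (rcons s z) = rcons (steps x s) (last x s, z).
Proof. by rewrite /steps -cats1 pairmap_cat cats1. Qed.

Lemma mem_steps (T : eqType) (x : T) (s : seq T) (p : T * T) :
  p \in steps x s -> p.1 \in belast x s /\ p.2 \in s.
Proof.
elim: s x => //= y s IH x; rewrite !inE => /orP[/eqP->/=|/IH[h1 h2]].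
  by rewrite !eqxx.
by rewrite h1 h2 !orbT.
Qed.

(** Every step of the path is disjoint from [{i, j}], so the commutation relation moves [x (i, j)]
    past one step at a time. *)
Lemma FK_steps_comm n (B : algType rat) (x : pair_t n -> B) (i j k : 'I_n)
    (s : seq 'I_n) : FK_rel x -> uniq (k :: s) -> i != j ->
  i \notin k :: s -> j \notin k :: s ->
  x (i, j) * \prod_(p <- steps k s) x p = (\prod_(p <- steps k s) x p) * x (i, j).
Proof.
move=> [_ _ _ FKc _]; elim: s k => [|l s IH] k.
  by move=> *; rewrite big_nil mulr1 mul1r.
rewrite cons_uniq => /andP[kls uls] ij ni nj.
rewrite /steps /= big_cons mulrA FKc; last first.
  rewrite /= !inE.
  move: kls ni nj; rewrite !inE !negb_or => /andP[-> _].
  by move=> /and3P[-> -> _] /and3P[-> -> _]; rewrite ij.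
rewrite -!mulrA IH //.
  by move: ni; rewrite inE negb_or => /andP[].
by move: nj; rewrite inE negb_or => /andP[].
Qed.

(* Insert the new vertex z between the last vertex y and a: the triangle relation
   x_yz x_za = x_za x_ya + x_ya x_yz, with x_za and x_yz commuting past the steps
   not touching them, reduces the sum to two copies of the shorter one. *)
Lemma FK_cycle n (B : algType rat) (x : pair_t n -> B) (a : 'I_n)
    (t : seq 'I_n) : FK_rel x -> uniq (a :: t) -> t != [::] ->
  \prod_(p <- steps a t) x p +
  \sum_(i < size t) (\prod_(p <- drop i.+1 (steps a t)) x p) * x (last a t, a) *
     \prod_(p <- take i (steps a t)) x p = 0.
Proof.
move=> FKx; have [_ FKa _ FKc FKt] := FKx.
elim/last_ind: t => // t z IH; rewrite -rcons_cons rcons_uniq => /andP[zat uat] _.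
(* For [t] empty the cycle is [a, z] and the relation is antisymmetry. *)
have [->|t0] := eqVneq t [::].
  rewrite /= big_ord1 /steps /= !big_cons !big_nil !mulr1 mul1r FKa ?addNr //.
  by move: zat; rewrite inE negb_or => /andP[].
have {IH} := IH uat t0; set q := steps a t => IH.
have szq : size q = size t by rewrite size_pairmap.
rewrite steps_rcons last_rcons size_rcons -/q big_rcons /=.
set y := last a t.
have yt : y \in t by rewrite /y; case: (t) t0 => //= b s _; apply: mem_last.
have ya : y != a by apply: contraTneq yt => ->; case/andP: uat.
have zy : z != y by apply: contraNneq zat => ->; rewrite inE yt orbT.
have za : z != a by apply: contraNneq zat => ->; rewrite mem_head.
rewrite big_ord_recr /= drop_oversize ?size_rcons ?szq // big_nil mul1r.
rewrite -cats1 (take_size_cat _ szq).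
have middle (i : 'I_(size t)) :
    \prod_(p <- drop i.+1 (q ++ [:: (y, z)])) x p * x (z, a) *
      \prod_(p <- take i (q ++ [:: (y, z)])) x p =
    x (z, a) * (\prod_(p <- drop i.+1 q) x p * x (y, a) *
      \prod_(p <- take i q) x p) +
    (\prod_(p <- drop i.+1 q) x p * x (y, a) *
      \prod_(p <- take i q) x p) * x (y, z).
  (* Summand [i] omits the step [(last a t1, k)]; its other old steps form two disjoint paths, which
     is what the commutations below use. *)
  have [t1 [k [t2 [tE st1]]]] : exists t1 k t2, t = t1 ++ k :: t2 /\ size t1 = i.
    exists (take i t), (nth a t i), (drop i.+1 t).
    by rewrite -drop_nth // cat_take_drop size_takel // ltnW.
  have qE : q = steps a t1 ++ (last a t1, k) :: steps k t2.
    by rewrite /q tE /steps pairmap_cat.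
  have sz1 : size (steps a t1) = i by rewrite size_pairmap.
  have sz2 : size (rcons (steps a t1) (last a t1, k)) = i.+1.
    by rewrite size_rcons sz1.
  have -> : drop i.+1 (q ++ [:: (y, z)]) = steps k t2 ++ [:: (y, z)].
    by rewrite qE -catA /= -cat_rcons (drop_size_cat _ sz2).
  have -> : take i (q ++ [:: (y, z)]) = steps a t1.
    by rewrite qE -catA (take_size_cat _ sz1).
  have -> : drop i.+1 q = steps k t2 by rewrite qE -cat_rcons (drop_size_cat _ sz2).
  have -> : take i q = steps a t1 by rewrite qE (take_size_cat _ sz1).
  have uakt : uniq (a :: t1 ++ k :: t2) by rewrite -tE.
  have yE : y = last k t2 by rewrite /y tE last_cat.
  have triangle : x (y, z) * x (z, a) = x (z, a) * x (y, a) + x (y, a) * x (y, z).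
    have := FKt y z a; rewrite /= !inE (eq_sym y z) negb_or zy ya za => /(_ isT).
    rewrite (FKa y a) // mulrN mulNr => /eqP; rewrite subr_eq0 subr_eq => /eqP->.
    by rewrite addrC.
  have comD : x (z, a) * \prod_(p <- steps k t2) x p =
              \prod_(p <- steps k t2) x p * x (z, a).
    apply: FK_steps_comm => //.
    - by move: uakt; rewrite -cat_cons cat_uniq => /and3P[].
    - by move: zat; rewrite tE inE mem_cat !negb_or => /and3P[].
    - by case/andP: uakt; rewrite mem_cat negb_or => /andP[].
  have comT : x (y, z) * \prod_(p <- steps a t1) x p =
              \prod_(p <- steps a t1) x p * x (y, z).
    apply: FK_steps_comm => //.
    - by move: uakt; rewrite -cat_cons cat_uniq => /and3P[].
    - by rewrite eq_sym.
    - move: uakt; rewrite -cat_cons cat_uniq => /and3P[_ /hasPn h _].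
      by rewrite yE; apply: h; apply: mem_last.
    - by move: zat; rewrite tE -cat_cons mem_cat negb_or => /andP[].
  rewrite big_cat /= big_seq1 -[_ * _ * x (z, a)]mulrA triangle.
  by rewrite mulrDr mulrDl !mulrA comD -!mulrA comT.
rewrite (eq_bigr _ (fun i _ => middle i)) big_split /= -mulr_sumr -mulr_suml.
(* By induction [S] is minus the product over [q]: [S * x (y, z)] cancels the leading product, and
   [x (z, a) * S] cancels the last summand, which omits the new step. *)
set S := \sum_(i < _) _ in IH *.
have -> : S = - \prod_(p <- q) x p by apply/eqP; rewrite -addr_eq0 addrC IH.
by rewrite mulrN mulNr addrAC addNr add0r subrr.
Qed.

(** * Linear dependences are spanned by cycles *)

Lemma uedge_swap n (p : pair_t n) : uedge (p.2, p.1) = uedge p.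
Proof.
case: p => i j; rewrite /uedge /=.
by case: (ltngtP i j) => // /val_inj ->.
Qed.

Lemma uedgeP n (p q : pair_t n) : uedge p = uedge q -> p = q \/ p = (q.2, q.1).
Proof.
case: p q => i j [k l]; rewrite /uedge /=.
by case: ifP => _; case: ifP => _ [-> ->]; by [left | right].
Qed.

Lemma uniq_map_inj (T1 T2 : eqType) (f : T1 -> T2) (s : seq T1) :
  uniq (map f s) -> {in s &, injective f}.
Proof.
elim: s => //= a s IH /andP[fa us] x y; rewrite !inE.
move=> /predU1P[->|xs] /predU1P[->|ys] // fxy.
- by case/negP: fa; rewrite fxy map_f.
- by case/negP: fa; rewrite -fxy map_f.
- exact: IH.
Qed.

Lemma uniq_uedge_steps n (a : 'I_n) (t : seq 'I_n) :
  uniq (a :: t) -> uniq (map (@uedge n) (steps a t)).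
Proof.
elim: t a => // b t IH a; rewrite cons_uniq => /andP[abt ubt].
rewrite /= (IH _ ubt) andbT; apply/mapP => -[[c d] /mem_steps[/= h1 h2]].
case/uedgeP => -[ac bd]; move: abt; rewrite ac.
  by rewrite (mem_belast h1).
by rewrite inE h2 orbT.
Qed.

Lemma path_steps (T : eqType) (r : rel T) (a : T) (t : seq T) (p : T * T) :
  path r a t -> p \in steps a t -> r p.1 p.2.
Proof.
elim: t a => //= b t IH a /andP[rab pbt].
by rewrite inE => /predU1P[->|/(IH _ pbt)].
Qed.

(** The relation of [FK_cycle], only along cycles with all edges in [e]; this is the part visible
    inside the subalgebra of a graph. For [t] a singleton it is antisymmetry. *)
Definition cycle_rels n (e : rel 'I_n) (A : comAlgType rat) (u : pair_t n -> A) :=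
  forall (a : 'I_n) (t : seq 'I_n), uniq (a :: t) -> t != [::] ->
    path e a t -> e (last a t) a ->
  \prod_(p <- steps a t) u p +
  \sum_(i < size t) (\prod_(p <- drop i.+1 (steps a t)) u p) * u (last a t, a) *
     \prod_(p <- take i (steps a t)) u p = 0.

(* The eps-coefficient of the product of the u_i + c_i eps is the sum of the
   c_i * prod_(j != i) u_j, the left-hand side of the Orlik-Terao relation. *)
Definition deform (I : Type) (A : comAlgType rat) (u : I -> A) (c : I -> rat)
  (i : I) : dual A := (u i, (c i)%:A).

Lemma prod_deform1 (I : Type) (A : comAlgType rat) (u : I -> A) (c : I -> rat)
    (r : seq I) : (\prod_(i <- r) deform u c i).1 = \prod_(i <- r) u i.
Proof.
by elim: r => [|i r IH]; rewrite ?big_nil // !big_cons dualM /= IH.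
Qed.

(** The factors after the omitted one stand first, as in the rotations of [FK_cycle]. *)
Lemma prod_deform_one (I : Type) (A : comAlgType rat) (u : I -> A) (r : seq I) :
  (\prod_(i <- r) deform u (fun=> 1) i).2 =
  \sum_(i < size r) (\prod_(p <- drop i.+1 r) u p) * \prod_(p <- take i r) u p.
Proof.
elim: r => [|i r IH]; first by rewrite big_nil big_ord0.
rewrite big_cons dualM /= IH prod_deform1 big_ord_recl /= drop0 big_nil mulr1.
rewrite scale1r mul1r addrC mulr_sumr; congr (_ + _).
by apply: eq_bigr => j _; rewrite big_cons mulrCA.
Qed.

Lemma prod_deform (I : finType) (A : comAlgType rat) (u : I -> A) (c : I -> rat) :
  (\prod_i deform u c i).2 = \sum_i c i *: \prod_(j | j != i) u j.
Proof.
elim: (index_enum I) (index_enum_uniq I) => [|i r IH] /=.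
  by rewrite !big_nil.
case/andP => ir /IH{}IH; rewrite !big_cons dualM /= IH prod_deform1 eqxx /=.
rewrite addrC -scalerAl mul1r; congr (_ *: _ + _).
  rewrite [LHS]big_seq [RHS]big_seq_cond; apply: eq_bigl => j.
  by case: (boolP (j \in r)) => //= jr; apply/esym; apply: contraNneq ir => <-.
rewrite mulr_sumr [LHS]big_seq [RHS]big_seq; apply: eq_bigr => j jr.
by rewrite big_cons -scalerAr ifT //; apply: contraNneq ir => ->.
Qed.

(** The cycle relation is the dependence relation with all coefficients 1: omitting the closing step
    gives its leading product, omitting any other step gives a summand. *)
Lemma cycle_relsE n (e : rel 'I_n) (A : comAlgType rat) (u : pair_t n -> A)
    (a : 'I_n) (t : seq 'I_n) : cycle_rels e u ->
  uniq (a :: t) -> t != [::] -> path e a t -> e (last a t) a ->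
  ((\prod_(p <- steps a t) deform u (fun=> 1) p) *
     deform u (fun=> 1) (last a t, a)).2 = 0.
Proof.
move=> cyc uat t0 pe ce; rewrite -[RHS](cyc a t) // dualM /= prod_deform1.
rewrite prod_deform_one scale1r mulr1 size_pairmap mulr_suml; congr (_ + _).
by apply: eq_bigr => i _; rewrite mulrAC.
Qed.

(* Pairing with arbitrary functionals chi on vertices; see delta_dependent for
   the agreement with linear dependence of the e_i - e_j. *)
Definition dependent n (I : finType) (c : I -> rat) (p : I -> pair_t n) :=
  forall chi : 'I_n -> rat, \sum_i c i * (chi (p i).1 - chi (p i).2) = 0.

Lemma sum_steps n (chi : 'I_n -> rat) (a : 'I_n) (t : seq 'I_n) :
  \sum_(z <- steps a t) (chi z.1 - chi z.2) = chi a - chi (last a t).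
Proof.
elim: t a => [|b t IH] a; first by rewrite big_nil subrr.
by rewrite /steps /= big_cons IH /= addrA subrK.
Qed.

(* The endpoints (a, b) of t0 stay connected in the support of c without t0,
   as seen by testing c against the indicator of the component of b; t0 then
   closes a path from b to a into a cycle. *)
Lemma extract_cycle n (e : rel 'I_n) (A : comAlgType rat) (u : pair_t n -> A)
    (I : finType) (c : I -> rat) (p : I -> pair_t n) (t0 : I) :
  symmetric e -> irreflexive e ->
  (forall i j, e i j -> u (j, i) = - u (i, j)) -> cycle_rels e u ->
  (forall t, e (p t).1 (p t).2) -> dependent c p -> c t0 != 0 ->
  exists d : I -> rat, [/\ d t0 = 1, forall t, c t = 0 -> d t = 0,
    dependent d p & (\prod_t deform (u \o p) d t).2 = 0].
Proof.
move=> e_sym e_irr anti cyc pe dep ct0.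
pose good z t := [&& t != t0, c t != 0 & (p t == z) || (p t == (z.2, z.1))].
pose r := [rel v w | [exists t, good (v, w) t]].
have r_sym : symmetric r.
  by move=> v w; apply: eq_existsb => t; rewrite /good /= orbC.
case pt0 : (p t0) => [a b].
have eab : e a b by have := pe t0; rewrite pt0.
have conn : connect r b a.
  have /eqP := dep (fun v => (connect r b v)%:R).
  rewrite (bigD1 t0) //= big1 ?addr0 => [|t tt0].
    rewrite pt0 /= connect0 mulf_eq0 (negPf ct0) /=.
    by case: (connect r b a) => //; rewrite sub0r oppr_eq0 oner_eq0.
  have [->|ct] := eqVneq (c t) 0; first by rewrite mul0r.
  have rt : r (p t).1 (p t).2.
    by apply/existsP; exists t; rewrite /good tt0 ct -surjective_pairing eqxx.
  have -> : connect r b (p t).1 = connect r b (p t).2; last by rewrite subrr mulr0.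
  apply/idP/idP => h; apply: connect_trans h _; apply: connect1 => //.
  by rewrite r_sym.
case/connectP: conn => s0 ps0; case/shortenP: ps0 => s ps us _ al {s0}.
have r_e v w : r v w -> e v w.
  case/existsP => t /and3P[_ _ /orP[]/eqP pt]; have := pe t; rewrite pt //=.
  by rewrite e_sym.
have s0 : s != [::].
  by apply: contraTneq eab => s0; rewrite al s0 /= e_irr.
have pes : path e b s by apply: sub_path ps.
have ce : e (last b s) b by rewrite -al.
(* Chooses an index carrying the step [z]. On steps of the path one exists, so the default [t0]
   never occurs there. *)
pose tau z := odflt t0 [pick t | good z t].
have tauP z : z \in steps b s -> good z (tau z).
  move=> zs; rewrite /tau; case: pickP => // no.
  have /existsP[t] := path_steps ps zs.
  by rewrite -surjective_pairing no.
have uedge_tau z : z \in steps b s -> uedge (p (tau z)) = uedge z.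
  by case/tauP/and3P => _ _ /orP[]/eqP-> //; apply: uedge_swap.
pose T := map tau (steps b s).
have uT : uniq (t0 :: T).
  rewrite /=; apply/andP; split.
    by apply/mapP => -[z /tauP/and3P[+ _ _] E]; rewrite -E eqxx.
  (* The undirected edges of the steps are distinct, which separates the chosen indices. *)
  apply: (map_uniq (f := fun t => uedge (p t))).
  have -> : map (fun t => uedge (p t)) T = map (@uedge n) (steps b s).
    by rewrite -map_comp; apply/eq_in_map => z /uedge_tau.
  exact: uniq_uedge_steps us.
(* The sign records whether the path traverses [p t] in its own direction. *)
pose d t : rat := if t == t0 then 1 else if t \in T then
  (if p t \in steps b s then 1 else -1) else 0.
have dT t : t \notin t0 :: T -> d t = 0.
  by rewrite inE negb_or /d => /andP[/negPf-> /negPf->].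
have dtau z : z \in steps b s -> (p (tau z) = z /\ d (tau z) = 1) \/
    (p (tau z) = (z.2, z.1) /\ d (tau z) = -1).
  move=> zs; have /and3P[taut0 _ taup] := tauP _ zs.
  have zT : tau z \in T by apply: map_f.
  rewrite /d (negPf taut0) zT; case/orP: taup => /eqP pz; rewrite pz.
    by left; rewrite zs.
  right; rewrite ifN //; apply/negP => zs'.
  (* If the path contained both [z] and its reverse, distinctness of undirected edges would make [z]
     a loop. *)
  have zz := uniq_map_inj (uniq_uedge_steps us) zs' zs (uedge_swap z).
  have := path_steps pes zs; rewrite -zz /=.
  by move: zz; case: (z) => v w [-> _]; rewrite e_irr.
exists d; split.
- by rewrite /d eqxx.
- move=> t ct; rewrite /d; case: eqVneq => [tt0|_]; first by rewrite -tt0 ct eqxx in ct0.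
  case: ifP => // /mapP[z /tauP/and3P[_ + _] tz].
  by rewrite -tz ct eqxx.
- move=> chi; rewrite (bigID (mem (t0 :: T))) /= -big_uniq //=.
  rewrite [X in _ + X]big1 ?addr0 => [|t /dT->]; last by rewrite mul0r.
  rewrite big_cons big_map {1}/d eqxx pt0 mul1r /=.
  rewrite (eq_big_seq (fun z => chi z.1 - chi z.2)) => [|z /dtau].
    by rewrite sum_steps -al addrA subrK subrr.
  by case=> -[-> ->] /=; rewrite ?mul1r // mulN1r opprB.
(* Off the cycle [d] is 0, so those factors have no eps part and it suffices to treat the cycle. *)
rewrite (bigID (mem (t0 :: T))) /= -big_uniq //=.
have other : (\prod_(t | t \notin t0 :: T) deform (u \o p) d t).2 = 0.
  elim/big_rec: _ => // t y /dT dt0 y0.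
  by rewrite dualM /= y0 dt0 scale0r mulr0 mul0r addr0.
rewrite other mulr0 add0r.
suff -> : (\prod_(i <- t0 :: T) deform (u \o p) d i).2 = 0 by rewrite mul0r.
pose w : pair_t n -> dual A := deform u (fun=> 1).
(* For a reversed step both [u] and [d] change sign, so the dual number is minus that of the step;
   the signs then leave the product as one scalar. *)
have tauE z : z \in steps b s -> deform (u \o p) d (tau z) = d (tau z) *: w z.
  move=> zs; rewrite /deform /=; case: (dtau z zs) => -[-> ->].
    by rewrite [RHS]scale1r.
  have uz : u (z.2, z.1) = - u z.
    by rewrite anti -?surjective_pairing //; apply: path_steps pes zs.
  by rewrite [RHS]scaleN1r uz scaleN1r /w /deform scale1r.
rewrite big_cons big_map (eq_big_seq _ tauE) scaler_prod.
have -> : deform (u \o p) d t0 = w (last b s, b).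
  by rewrite /deform /w /= pt0 /d eqxx al.
rewrite mulrC -scalerAl.
have := cycle_relsE cyc us s0 pes ce.
by rewrite -/w; set X := _ * _ => X0; rewrite -[LHS]/(_ *: X.2) X0 scaler0.
Qed.

(** Induction on the size of the support of [c]: subtracting [c t0] times the cycle [d] through [t0]
    removes [t0] from the support and adds nothing, and the eps part is linear in the
    coefficients. *)
Lemma dep_rels n (e : rel 'I_n) (A : comAlgType rat) (u : pair_t n -> A)
    (I : finType) (c : I -> rat) (p : I -> pair_t n) :
  symmetric e -> irreflexive e ->
  (forall i j, e i j -> u (j, i) = - u (i, j)) -> cycle_rels e u ->
  (forall t, e (p t).1 (p t).2) -> dependent c p ->
  (\prod_t deform (u \o p) c t).2 = 0.
Proof.
move=> e_sym e_irr anti cyc pe.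
have [m] := ubnP #|[pred t | c t != 0]|; elim: m c => // m IH c lem dep.
case: (pickP [pred t | c t != 0]) => [t0 /= ct0|no]; last first.
  rewrite prod_deform big1 // => t _.
  by have /negbFE/eqP-> := no t; rewrite scale0r.
have [d [d0 dc depd reld]] := extract_cycle e_sym e_irr anti cyc pe dep ct0.
have := IH (fun t => c t - c t0 * d t).
rewrite !prod_deform.
have -> : \sum_i (c i - c t0 * d i) *: \prod_(j | j != i) (u \o p) j =
  \sum_i c i *: \prod_(j | j != i) (u \o p) j -
  c t0 *: \sum_i d i *: \prod_(j | j != i) (u \o p) j.
  rewrite scaler_sumr -sumrB; apply: eq_bigr => i _.
  by rewrite scalerBl scalerA.
rewrite prod_deform in reld; rewrite reld scaler0 subr0; apply.
- rewrite -ltnS; apply: leq_trans lem; rewrite ltnS; apply: proper_card.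
  apply/properP; split.
    apply/subsetP => t; rewrite !inE; apply: contraNneq => ct.
    by rewrite ct dc // mulr0 subr0.
  by exists t0; rewrite !inE //= d0 mulr1 subrr eqxx.
- move=> chi; transitivity (\sum_i c i * (chi (p i).1 - chi (p i).2) -
    c t0 * \sum_i d i * (chi (p i).1 - chi (p i).2)).
    rewrite mulr_sumr -sumrB; apply: eq_bigr => i _.
    by rewrite mulrBl mulrA.
  by rewrite dep depd mulr0 subr0.
Qed.

(** * The Orlik-Terao ideal of a contracted graph *)

Fixpoint prod_term (V : Type) (l : seq (rat * V)) : ncterm V :=
  if l is z :: l' then NMul (NVar z.2) (prod_term l') else NConst V 1.

(** Leibniz rule: the omitted factor is either the head, which contributes its coefficient, or lies
    in the tail. *)
Fixpoint dep_term (V : Type) (l : seq (rat * V)) : ncterm V :=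
  if l is z :: l' then
    NAdd (NMul (NConst V z.1) (prod_term l')) (NMul (NVar z.2) (dep_term l'))
  else NConst V 0.

Lemma ncev_prod_term (V : Type) (B : algType rat) (u : V -> B) (l : seq (rat * V)) :
  ncev u (prod_term l) = \prod_(z <- l) u z.2.
Proof.
by elim: l => [|z l IH]; rewrite ?big_nil ?big_cons /= ?scale1r ?IH.
Qed.

Lemma ncev_dep_term (V : Type) (A : comAlgType rat) (u : V -> A)
    (l : seq (rat * V)) :
  ncev u (dep_term l) = (\prod_(z <- l) deform (fun z => u z.2) fst z).2.
Proof.
elim: l => [|z l IH]; first by rewrite big_nil /= scale0r.
by rewrite big_cons dualM /= -IH prod_deform1 ncev_prod_term addrC.
Qed.

Lemma prod_term_over (V : eqType) (E : seq V) (l : seq (rat * V)) :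
  all (fun z => z.2 \in E) l -> term_over (fun p => p \in E) (prod_term l).
Proof. by elim: l => //= z l IH /andP[-> /IH]. Qed.

Definition list_dep n (phi : 'I_n -> 'I_n) (l : seq (rat * pair_t n)) :=
  forall chi : 'I_n -> rat,
    \sum_(z <- l) z.1 * (chi (phi z.2.1) - chi (phi z.2.2)) = 0.

(* The edges in E are taken with endpoints identified along phi, so that
   parallel edges may occur. *)
Inductive dep_ideal n (E : seq (pair_t n)) (phi : 'I_n -> 'I_n) :
    ncterm (pair_t n) -> Prop :=
| DI_sq p : p \in E -> dep_ideal E phi (NMul (NVar p) (NVar p))
| DI_dep l : all (fun z => z.2 \in E) l -> list_dep phi l ->
    dep_ideal E phi (dep_term l)
| DI_add s t : dep_ideal E phi s -> dep_ideal E phi t -> dep_ideal E phi (NAdd s t)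
| DI_mul s t : term_over (fun p => p \in E) s -> dep_ideal E phi t ->
    dep_ideal E phi (NMul s t)
| DI_eq s t :
    (forall (B : comAlgType rat) (u : pair_t n -> B), ncev u s = ncev u t) ->
    dep_ideal E phi s -> dep_ideal E phi t.

Lemma term_over_sub (V : Type) (P Q : V -> bool) (t : ncterm V) :
  (forall v, P v -> Q v) -> term_over P t -> term_over Q t.
Proof.
move=> PQ; elim: t => //= s IHs t IHt.
  by case/andP => /IHs-> /IHt->.
by case/andP => /IHs-> /IHt->.
Qed.

Lemma dep_ideal_sub n (E F : seq (pair_t n)) (phi : 'I_n -> 'I_n) f :
  {subset E <= F} -> dep_ideal E phi f -> dep_ideal F phi f.
Proof.
move=> EF; elim=> {f}.
- by move=> p /EF; apply: DI_sq.
- move=> l /allP lE; apply: DI_dep; apply/allP => z /lE; exact: EF.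
- by move=> s t _ hs _; apply: DI_add.
- by move=> s t so _; apply: DI_mul; apply: term_over_sub so => p; apply: EF.
- by move=> s t st _; apply: DI_eq.
Qed.

Lemma dep_ideal_sound n (E : seq (pair_t n)) (phi : 'I_n -> 'I_n)
    (A : comAlgType rat) (u : pair_t n -> A) f :
  {in E, forall p, u p * u p = 0} ->
  (forall l, all (fun z => z.2 \in E) l -> list_dep phi l ->
     (\prod_(z <- l) deform (fun z => u z.2) fst z).2 = 0) ->
  dep_ideal E phi f -> ncev u f = 0.
Proof.
move=> sq dep; elim=> {f} /=.
- exact: sq.
- by move=> l lE /dep; rewrite ncev_dep_term; apply.
- by move=> s t _ -> _ ->; rewrite addr0.
- by move=> s t _ _ ->; rewrite mulr0.
- by move=> s t <-.
Qed.

Definition contract_eval n (phi : 'I_n -> 'I_n) (A : Type) (y : pair_t n -> A)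
  (p : pair_t n) : A := y (phi p.1, phi p.2).

Lemma FK_cycle_rels n (A : comAlgType rat) (y : pair_t n -> A) :
  FK_rel y -> cycle_rels [rel i j | i != j] y.
Proof. by move=> FKy a t ut t0 _ _; apply: FK_cycle. Qed.

(** A commutative Fomin-Kirillov model satisfies the cycle relations of the complete graph.
    Looplessness makes the contracted edges edges of that graph, so [dep_rels] applies. *)
Lemma FK_dep_ideal n (E : seq (pair_t n)) (phi : 'I_n -> 'I_n)
    (A : comAlgType rat) (y : pair_t n -> A) f :
  {in E, forall p, phi p.1 != phi p.2} -> FK_rel y ->
  dep_ideal E phi f -> ncev (contract_eval phi y) f = 0.
Proof.
move=> loopless FKy; have [_ anti sq _ _] := FKy.
apply: dep_ideal_sound => [p pE|l lE dl]; first exact/sq/loopless.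
pose z := tnth (in_tuple l).
rewrite big_tnth.
have z_in t : z t \in l by apply: mem_tnth.
apply: (@dep_rels n [rel i j | i != j] A y _ (fun t => (z t).1)
  (fun t => (phi (z t).2.1, phi (z t).2.2))).
- by move=> i j; rewrite /= eq_sym.
- by move=> i /=; rewrite eqxx.
- exact: anti.
- exact: FK_cycle_rels.
- by move=> t; apply: loopless; apply: (allP lE).
- by move=> chi; have := dl chi; rewrite big_tnth.
Qed.

(** Expansion in the variable [p0] to first order. The remainder [r] may still contain [p0]; its
    multiple of the square is absorbed by [DI_sq]. *)
Lemma split_var n (E : seq (pair_t n)) (p0 : pair_t n) (f : ncterm (pair_t n)) :
  term_over (fun p => p \in p0 :: E) f ->
  exists g h r, [/\ term_over (fun p => p \in E) g,
    term_over (fun p => p \in E) h, term_over (fun p => p \in p0 :: E) r &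
    forall (B : comAlgType rat) (u : pair_t n -> B),
      ncev u f = ncev u g + u p0 * ncev u h + u p0 * u p0 * ncev u r].
Proof.
pose N0 := NConst (pair_t n) 0; pose N1 := NConst (pair_t n) 1.
have sub (t : ncterm (pair_t n)) : term_over (fun p => p \in E) t ->
    term_over (fun p => p \in p0 :: E) t.
  by apply: term_over_sub => p; rewrite inE orbC => ->.
elim: f => [p|c|s IHs t IHt|s IHs t IHt] /=.
- rewrite inE => /predU1P[->|pE].
    exists N0, N1, N0; split=> // B u.
    by rewrite /= !scale0r scale1r mulr1 mulr0 add0r addr0.
  by exists (NVar p), N0, N0; split=> // B u; rewrite /= !scale0r !mulr0 !addr0.
- by move=> _; exists (NConst _ c), N0, N0; split=> // B u;
    rewrite /= !scale0r !mulr0 !addr0.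
- case/andP => /IHs[g1 [h1 [r1 [og1 oh1 or1 e1]]]] /IHt[g2 [h2 [r2 [og2 oh2 or2 e2]]]].
  exists (NAdd g1 g2), (NAdd h1 h2), (NAdd r1 r2).
  split; rewrite /= ?og1 ?oh1 ?or1 // => B u; rewrite e1 e2; ring.
case/andP => /IHs[g1 [h1 [r1 [og1 oh1 or1 e1]]]] /IHt[g2 [h2 [r2 [og2 oh2 or2 e2]]]].
exists (NMul g1 g2), (NAdd (NMul g1 h2) (NMul h1 g2)).
exists (NAdd (NAdd (NMul (NAdd g1 (NMul (NVar p0) h1)) r2)
                   (NMul r1 (NAdd g2 (NMul (NVar p0) h2))))
             (NAdd (NMul h1 h2) (NMul (NMul (NVar p0) (NVar p0)) (NMul r1 r2)))).
split; rewrite /= ?og1 ?og2 ?oh1 ?oh2 ?or1 ?or2 ?sub ?mem_head // => B u.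
rewrite e1 e2; ring.
Qed.

(** Induction on the derivation. A dependence [l] after merging becomes one before merging once [p0]
    is added with a suitable coefficient [c0]; its relation is [c0] times the product of [l] plus
    [p0] times the relation of [l], so the latter is congruent to a term free of [p0]. *)
Lemma dep_ideal_contract n (E : seq (pair_t n)) (p0 : pair_t n)
    (phi pi : 'I_n -> 'I_n) (h : ncterm (pair_t n)) :
  (forall v, pi v = if v == phi p0.2 then phi p0.1 else v) ->
  dep_ideal E (pi \o phi) h ->
  exists g, term_over (fun p => p \in E) g /\
    dep_ideal (p0 :: E) phi
      (NAdd (NMul (NVar p0) h) (NMul (NConst _ (-1)) g)).
Proof.
move=> piE; pose N0 := NConst (pair_t n) 0.
have zero : dep_ideal (p0 :: E) phi N0.
  by apply: (DI_dep (l := [::])) => // chi; rewrite big_nil.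
have sub (t : ncterm (pair_t n)) : term_over (fun p => p \in E) t ->
    term_over (fun p => p \in p0 :: E) t.
  by apply: term_over_sub => p; rewrite inE orbC => ->.
elim=> {h}.
- move=> p pE; exists N0; split=> //.
  apply: (@DI_eq _ _ _ (NMul (NVar p0) (NMul (NVar p) (NVar p)))).
    by move=> B u /=; rewrite scale0r mulr0 addr0.
  by apply: DI_mul; rewrite /= ?mem_head //; apply: DI_sq; rewrite inE pE orbT.
- move=> l lE dl.
  (* c0 is the multiple of p0 by which l fails to be dependent before merging. *)
  pose c0 := \sum_(z <- l) z.1 * ((phi z.2.1 == phi p0.2)%:R - (phi z.2.2 == phi p0.2)%:R).
  exists (NMul (NConst _ (- c0)) (prod_term l)); split.
    by rewrite /= prod_term_over.
  apply: (@DI_eq _ _ _ (dep_term ((c0, p0) :: l))).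
    by move=> B u /=; rewrite scaleN1r mulrA mulN1r scaleNr opprK; ring.
  apply: DI_dep; rewrite /= ?mem_head /=.
    by apply: sub_all lE => z; rewrite inE orbC => ->.
  move=> chi; rewrite big_cons /=.
  (* Composing [chi] with [pi] changes it only at [phi p0.2], so the two sums differ by that change
     times [c0]. *)
  have -> : \sum_(z <- l) z.1 * (chi (phi z.2.1) - chi (phi z.2.2)) =
     \sum_(z <- l) z.1 * (chi (pi (phi z.2.1)) - chi (pi (phi z.2.2))) +
     (chi (phi p0.2) - chi (phi p0.1)) * c0.
    rewrite mulr_sumr -big_split /=; apply: eq_bigr => z _; rewrite !piE.
    case: eqP => [->|_]; case: eqP => [->|_] /=; ring.
  have /= -> := dl chi; ring.
- move=> s t _ [g1 [o1 i1]] _ [g2 [o2 i2]]; exists (NAdd g1 g2); split.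
    by rewrite /= o1.
  by apply: DI_eq (DI_add i1 i2) => B u /=; ring.
- move=> s t os _ [g [og ig]]; exists (NMul s g); split; first by rewrite /= os.
  by apply: DI_eq (DI_mul (sub _ os) ig) => B u /=; ring.
- move=> s t st _ [g [og ig]]; exists g; split => //.
  by apply: DI_eq ig => B u /=; rewrite st.
Qed.

(** * Deletion and contraction of an edge *)

Definition merge_vertex (T : eqType) (a b v : T) : T := if v == b then a else v.

(* The edge between a and b is sent to +-eps, all others to the model of the
   graph where b is merged into a. *)
Definition dual_model n (A : comAlgType rat) (y : pair_t n -> A) (a b : 'I_n)
    (p : pair_t n) : dual A :=
  if (p.1 == a) && (p.2 == b) then (0, 1) else
  if (p.1 == b) && (p.2 == a) then (0, -1) else
  (y (merge_vertex a b p.1, merge_vertex a b p.2), 0).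

(** A triangle missing [a] or [b] becomes a triangle of [y]. In one with vertices [a, b, k] the eps
    terms cancel by antisymmetry, and what remains is, up to sign, the square of [y (a, k)]. *)
Lemma dual_model_FK n (A : comAlgType rat) (y : pair_t n -> A) (a b : 'I_n) :
  a != b -> FK_rel y -> FK_rel (dual_model y a b).
Proof.
move=> ab [diag anti sq _ tri].
have ba : b != a by rewrite eq_sym.
have anti' i j : y (j, i) = - y (i, j).
  by have [->|/anti//] := eqVneq i j; rewrite diag oppr0.
have sq' i j : y (i, j) * y (i, j) = 0.
  by have [->|/sq//] := eqVneq i j; rewrite diag mulr0.
split.
- move=> i; rewrite /dual_model /= diag.
  by have [->|_] := eqVneq i a; rewrite ?(negPf ab) ?andbF.
{ move=> i j ij; rewrite /dual_model /=.
  have [jE|ja] := eqVneq j a; have [jE'|jb] := eqVneq j b;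
  have [iE|ia] := eqVneq i a; have [iE'|ib] := eqVneq i b; subst => //=.
  all: try by rewrite eqxx in ab.
  all: try by rewrite eqxx in ij.
  all: by congr (_, _) => /=; rewrite ?oppr0 ?opprK. }
- move=> i j ij; rewrite dualM /dual_model.
  case: ifP => _ /=; first by rewrite !mulr0 mul0r addr0.
  case: ifP => _ /=; first by rewrite !mulr0 mul0r addr0.
  by rewrite sq' mulr0 mul0r addr0.
- by move=> *; rewrite mulrC.
move=> i j k; rewrite /= !inE negb_or andbT => /andP[/andP[ij ik] jk].
rewrite !dualM /dual_model /merge_vertex /=.
have [iE|ia] := eqVneq i a; have [iE'|ib] := eqVneq i b;
have [jE|ja] := eqVneq j a; have [jE'|jb] := eqVneq j b;
have [kE|ka] := eqVneq k a; have [kE'|kb] := eqVneq k b => /=; subst.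
all: try by rewrite eqxx in ab.
all: try by rewrite eqxx in ij.
all: try by rewrite eqxx in ik.
all: try by rewrite eqxx in jk.
all: congr (_, _) => /=; last by rewrite ?(anti' a i) ?(anti' a j) ?(anti' a k); ring.
all: try by rewrite !(mulr0, mul0r, addr0, add0r) ?(anti' a i) ?(anti' a j)
  ?(anti' a k) ?mulrN ?mulNr sq' oppr0.
all: by apply: tri; rewrite /= !inE negb_or ?(eq_sym a) ?ij ?ik ?jk ?ia ?ja ?ka.
Qed.

(** Induction on the edge list for all [phi] at once, so that the hypothesis covers both deletion
    and contraction of [p0]. *)
Lemma dep_ideal_complete n (E : seq (pair_t n)) (phi : 'I_n -> 'I_n)
    (f : ncterm (pair_t n)) :
  {in E, forall p, phi p.1 != phi p.2} -> term_over (fun p => p \in E) f ->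
  (forall (A : comAlgType rat) (y : pair_t n -> A), FK_rel y ->
     ncev (contract_eval phi y) f = 0) ->
  dep_ideal E phi f.
Proof.
elim: E phi f => [|p0 E IH] phi f loopless of0 vanish.
  (* Without edges [f] is a constant, which the zero model forces to be 0, the relation of the empty
     dependence. *)
  have [c cE] : exists c, forall (B : comAlgType rat) (u : pair_t n -> B),
      ncev u f = c%:A.
    elim: f of0 {vanish} => //= [c _|s IHs t IHt|s IHs t IHt]; first by exists c.
      case/andP => /IHs[c1 e1] /IHt[c2 e2]; exists (c1 + c2) => B u.
      by rewrite e1 e2 scalerDl.
    case/andP => /IHs[c1 e1] /IHt[c2 e2]; exists (c1 * c2) => B u.
    by rewrite e1 e2 -scalerAl mul1r scalerA.
  have := vanish _ _ (FK_zero n); rewrite cE => /eqP.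
  rewrite scaler_eq0 oner_eq0 orbF => /eqP c0.
  apply: (@DI_eq _ _ _ (dep_term [::])).
    by move=> B u; rewrite cE c0.
  by apply: DI_dep => // chi; rewrite big_nil.
have looplessE : {in E, forall p, phi p.1 != phi p.2}.
  by move=> p pE; apply: loopless; rewrite inE pE orbT.
have sub (t : ncterm (pair_t n)) : term_over (fun p => p \in E) t ->
    term_over (fun p => p \in p0 :: E) t.
  by apply: term_over_sub => p; rewrite inE orbC => ->.
have subE : {subset E <= p0 :: E} by move=> p pE; rewrite inE pE orbT.
have lp0 : phi p0.1 != phi p0.2 by apply: loopless; rewrite mem_head.
have sq0 (t : ncterm (pair_t n)) : term_over (fun p => p \in p0 :: E) t ->
    dep_ideal (p0 :: E) phi (NMul t (NMul (NVar p0) (NVar p0))).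
  by move=> ot; apply: DI_mul => //; apply: DI_sq; rewrite mem_head.
have [g [h [r [og oh or fE]]]] := split_var of0.
(* An edge [p1] parallel to [p0] would become a loop under contraction. In that case [p0] is
   replaced by [p1] up to the orientation sign [sg]. *)
case: (boolP (has (fun p => ((phi p.1 == phi p0.1) && (phi p.2 == phi p0.2))
   || ((phi p.1 == phi p0.2) && (phi p.2 == phi p0.1))) E)) => [/hasP[p1 p1E par]|].
  pose sg : rat := if phi p1.1 == phi p0.1 then 1 else -1.
  pose f1 := NAdd g (NMul (NMul (NConst _ sg) (NVar p1)) h).
  have If1 : dep_ideal (p0 :: E) phi f1.
    apply: (dep_ideal_sub subE); apply: IH => //; first by rewrite /= og p1E.
    move=> A y FKy; have := vanish A y FKy; have [_ anti sq _ _] := FKy.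
    rewrite fE {4 5}/contract_eval sq // mul0r addr0 /= /contract_eval => <-.
    congr (_ + _ * _); rewrite /sg.
    case/orP: par => /andP[/eqP-> /eqP->]; first by rewrite eqxx scale1r mul1r.
    by rewrite eq_sym (negPf lp0) scaleN1r mulN1r anti ?opprK // eq_sym.
  have Idep : dep_ideal (p0 :: E) phi (dep_term [:: (1, p0); (- sg, p1)]).
    apply: DI_dep; first by rewrite /= !inE eqxx p1E orbT.
    move=> chi; rewrite !big_cons big_nil /= /sg.
    case/orP: par => /andP[/eqP-> /eqP->]; first by rewrite eqxx; ring.
    by rewrite eq_sym (negPf lp0); ring.
  have sg2 : sg * sg = 1 by rewrite /sg; case: ifP => _; ring.
  (* The relation reads [p1 - sg * p0]; since [sg * sg = 1], its multiple by [- sg * h] turns [f1]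
     into [g + p0 * h]. *)
  have Ih : dep_ideal (p0 :: E) phi
      (NMul (NMul (NConst _ (- sg)) h) (dep_term [:: (1, p0); (- sg, p1)])).
    by apply: DI_mul => //=; apply: sub.
  apply: DI_eq (DI_add (DI_add If1 Ih) (sq0 _ or)) => B u.
  rewrite fE /= !scale0r !scale1r scaleNr.
  have sA : sg%:A * sg%:A = 1 :> B by rewrite -scalerAl mul1r scalerA sg2 scale1r.
  transitivity (ncev u g + (sg%:A * sg%:A) * u p0 * ncev u h + u p0 * u p0 * ncev u r).
    by ring.
  by rewrite sA mul1r.
move/hasPn => nonpar.
have merge_neq p : p \in E -> merge_vertex (phi p0.1) (phi p0.2) (phi p.1) !=
    merge_vertex (phi p0.1) (phi p0.2) (phi p.2).
  move=> pE; rewrite /merge_vertex; have := nonpar p pE; have := looplessE p pE.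
  have [->|n1] := eqVneq (phi p.1) (phi p0.2);
  have [->|n2] := eqVneq (phi p.2) (phi p0.2) => //=.
  by rewrite orbC /= negb_or eq_sym => _ /andP[].
  by rewrite andbT orbF.
have Ih : dep_ideal E (merge_vertex (phi p0.1) (phi p0.2) \o phi) h.
  apply: IH => // A y FKy.
  have FKd := dual_model_FK lp0 FKy.
  set y' := dual_model _ _ _ in FKd.
  (* No edge of [E] is parallel to [p0], so terms over [E] evaluate without eps part; the eps part
     of [f] is then the contracted value of [h]. *)
  have evE t : term_over (fun p => p \in E) t -> ncev (contract_eval phi y') t =
      (ncev (contract_eval (merge_vertex (phi p0.1) (phi p0.2) \o phi) y) t, 0).
    elim: t => [p|c|s IHs t IHt|s IHs t IHt] //=.
    - move=> /nonpar; rewrite negb_or => /andP[n1 n2].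
      by rewrite /contract_eval /y' /dual_model /= (negPf n1) (negPf n2).
    - by move=> _; congr (_, _); rewrite /= scaler0.
    - by case/andP => /IHs-> /IHt->; congr (_, _); rewrite /= addr0.
    - by case/andP => /IHs-> /IHt->; congr (_, _); rewrite /= mulr0 mul0r addr0.
  have y'0 : contract_eval phi y' p0 = (0, 1).
    by rewrite /contract_eval /y' /dual_model /= !eqxx.
  have := vanish _ _ FKd; rewrite fE (evE _ og) (evE _ oh) y'0 => /(congr1 snd) /=.
  by rewrite !(mul0r, mulr0, add0r, mul1r, addr0).
have [g' [og' Ig']] := dep_ideal_contract (phi := phi)
  (pi := merge_vertex (phi p0.1) (phi p0.2)) (p0 := p0) (fun v => erefl) Ih.
(* Replacing [p0 * h] by the congruent [g'] preserves vanishing in all models, by soundness, and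
   eliminates [p0]. *)
have Igg : dep_ideal E phi (NAdd g g').
  apply: IH => //=; first by rewrite og.
  move=> A y FKy; have [_ _ sq _ _] := FKy.
  have := vanish _ _ FKy; rewrite fE {2 3}/contract_eval sq // mul0r addr0 => <-.
  have /= := FK_dep_ideal loopless FKy Ig'.
  by rewrite scaleN1r mulN1r => /eqP; rewrite subr_eq0 => /eqP->.
apply: DI_eq (DI_add (DI_add (dep_ideal_sub subE Igg) Ig') (sq0 _ or)) => B u.
by rewrite fE /= scaleN1r; ring.
Qed.

(** * The commutative quotient as an algebra *)

HB.instance Definition _ (V : Type) := gen_eqMixin (ncterm V).
HB.instance Definition _ (V : Type) := gen_choiceMixin (ncterm V).

(** Sending variables off the graph to 0 lets the quotient be formed on all expressions rather than
    on a subtype. *)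
Fixpoint restrict (V : Type) (P : V -> bool) (t : ncterm V) : ncterm V :=
  match t with
  | NVar v => if P v then NVar v else NConst V 0
  | NConst c => NConst V c
  | NAdd s u => NAdd (restrict P s) (restrict P u)
  | NMul s u => NMul (restrict P s) (restrict P u)
  end.

Lemma restrict_over (V : Type) (P : V -> bool) t : term_over P (restrict P t).
Proof.
by elim: t => //= [v|s -> t ->|s -> t ->] //; case: ifP => //= ->.
Qed.

Lemma restrict_id (V : Type) (P : V -> bool) t : term_over P t -> restrict P t = t.
Proof.
by elim: t => //= [v ->|s IHs t IHt|s IHs t IHt] // /andP[/IHs-> /IHt->].
Qed.

Lemma ncev_restrict (V : Type) (P : V -> bool) (B : algType rat) (x : V -> B) t :
  ncev x (restrict P t) = ncev (fun v => if P v then x v else 0) t.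
Proof.
by elim: t => //= [v|s -> t ->|s -> t ->] //; case: ifP => //= _; rewrite scale0r.
Qed.

Definition NSub (V : Type) (s t : ncterm V) := NAdd s (NMul (NConst V (-1)) t).

Lemma ncev_sub (V : Type) (B : algType rat) (x : V -> B) s t :
  ncev x (NSub s t) = ncev x s - ncev x t.
Proof. by rewrite /= scaleN1r mulN1r. Qed.

Lemma zero_EGab_ext n (e : rel 'I_n) f g :
  (forall (B : algType rat) (x : pair_t n -> B), FK_rel x -> ncev x f = ncev x g) ->
  zero_in_EGab e f -> zero_in_EGab e g.
Proof. by move=> fg [w [ow fw]]; exists w; split=> // B x FKx; rewrite -fg // fw. Qed.

Lemma zero_EGab0 n (e : rel 'I_n) f :
  (forall (B : algType rat) (x : pair_t n -> B), FK_rel x -> ncev x f = 0) ->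
  zero_in_EGab e f.
Proof.
by move=> f0; exists [::]; split=> // B x FKx; rewrite f0 // /comm_sum_ev big_nil.
Qed.

Lemma zero_EGabD n (e : rel 'I_n) f g :
  zero_in_EGab e f -> zero_in_EGab e g -> zero_in_EGab e (NAdd f g).
Proof.
move=> [v [ov fv]] [w [ow gw]]; exists (v ++ w); split; first by rewrite all_cat ov.
by move=> B x FKx; rewrite /= fv // gw // /comm_sum_ev big_cat.
Qed.

Lemma zero_EGabM n (e : rel 'I_n) s f t :
  term_over (is_edge e) s -> term_over (is_edge e) t ->
  zero_in_EGab e f -> zero_in_EGab e (NMul (NMul s f) t).
Proof.
move=> os ot [w [ow fw]].
exists [seq (NMul s z.1.1.1, z.1.1.2, z.1.2, NMul z.2 t) | z <- w]; split.
  by rewrite all_map; apply: sub_all ow => z /= /and4P[-> -> -> ->]; rewrite os ot.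
move=> B x FKx; rewrite /= fw // /comm_sum_ev big_map mulr_sumr mulr_suml.
by apply: eq_bigr => z _; rewrite /= !mulrA.
Qed.

Lemma zero_EGabC n (e : rel 'I_n) a b :
  term_over (is_edge e) a -> term_over (is_edge e) b ->
  zero_in_EGab e (NSub (NMul a b) (NMul b a)).
Proof.
move=> oa ob; exists [:: (NConst _ 1, a, b, NConst _ 1)]; split.
  by rewrite /= oa ob.
move=> B x _; rewrite ncev_sub /comm_sum_ev big_seq1 /=.
by rewrite scale1r mul1r mulr1.
Qed.

Lemma zero_EGab_comm n (e : rel 'I_n) f (A : comAlgType rat) (x : pair_t n -> A) :
  zero_in_EGab e f -> FK_rel x -> ncev x f = 0.
Proof.
move=> [w [_ fw]] FKx; rewrite fw // /comm_sum_ev big1 // => z _.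
by rewrite [X in X - _]mulrC subrr mulr0 mul0r.
Qed.

(** Congruence modulo the commutator ideal, made boolean by classical logic as the quotient
    construction requires. *)
Definition EGab_eqb n (e : rel 'I_n) (s t : ncterm (pair_t n)) : bool :=
  `[< zero_in_EGab e (restrict (is_edge e) (NSub s t)) >].

Lemma EGab_eqb_ext n (e : rel 'I_n) s t :
  (forall (B : algType rat) (x : pair_t n -> B), ncev x s = ncev x t) ->
  EGab_eqb e s t.
Proof.
move=> st; apply/asboolP/zero_EGab0 => B x _.
by rewrite ncev_restrict ncev_sub st subrr.
Qed.

Lemma EGab_eqb_refl n (e : rel 'I_n) : reflexive (EGab_eqb e).
Proof. by move=> t; apply: EGab_eqb_ext. Qed.

Lemma EGab_eqb_imp n (e : rel 'I_n) s t : EGab_eqb e s t -> EGab_eqb e t s.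
Proof.
move=> /asboolP st; apply/asboolP.
have := @zero_EGabM n e (NConst _ (-1)) _ (NConst _ 1) isT isT st.
apply: zero_EGab_ext => B x _; rewrite /= !ncev_restrict.
by rewrite scale1r mulr1 !scaleN1r !mulN1r opprD opprK addrC.
Qed.

Lemma EGab_eqb_sym n (e : rel 'I_n) : symmetric (EGab_eqb e).
Proof. by move=> s t; apply/idP/idP; apply: EGab_eqb_imp. Qed.

Lemma EGab_eqb_trans n (e : rel 'I_n) : transitive (EGab_eqb e).
Proof.
move=> t s r /asboolP st /asboolP tr; apply/asboolP.
apply: zero_EGab_ext (zero_EGabD st tr) => B x _; rewrite /= !ncev_restrict.
by rewrite !scaleN1r !mulN1r addrA subrK.
Qed.

Canonical EGab_equiv n (e : rel 'I_n) := EquivRel (EGab_eqb e)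
  (@EGab_eqb_refl n e) (@EGab_eqb_sym n e) (@EGab_eqb_trans n e).

Definition EGab n (e : rel 'I_n) := {eq_quot (EGab_equiv e)}.
HB.instance Definition _ n (e : rel 'I_n) := Choice.on (EGab e).
HB.instance Definition _ n (e : rel 'I_n) := Quotient.on (EGab e).

Definition EGab_pi n (e : rel 'I_n) (t : ncterm (pair_t n)) : EGab e := \pi_(EGab e) t.

Lemma EGab_piP n (e : rel 'I_n) s t :
  EGab_pi e s = EGab_pi e t <-> zero_in_EGab e (restrict (is_edge e) (NSub s t)).
Proof.
split=> [/eqquotP/asboolP //|st]; apply/eqquotP; exact/asboolP.
Qed.

Lemma EGab_piW n (e : rel 'I_n) (P : EGab e -> Prop) :
  (forall t, P (EGab_pi e t)) -> forall x, P x.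
Proof. by move=> h x; rewrite -[x]reprK; apply: h. Qed.

Lemma EGab_pi_ext n (e : rel 'I_n) s t :
  (forall (B : algType rat) (x : pair_t n -> B), ncev x s = ncev x t) ->
  EGab_pi e s = EGab_pi e t.
Proof. by move=> st; apply/eqquotP/EGab_eqb_ext. Qed.

Lemma EGab_piD n (e : rel 'I_n) s s' t t' :
  EGab_pi e s = EGab_pi e s' -> EGab_pi e t = EGab_pi e t' ->
  EGab_pi e (NAdd s t) = EGab_pi e (NAdd s' t').
Proof.
move=> /EGab_piP ss /EGab_piP tt; apply/EGab_piP.
apply: zero_EGab_ext (zero_EGabD ss tt) => B x _ /=.
by rewrite !ncev_restrict !scaleN1r !mulN1r opprD addrACA.
Qed.

Lemma EGab_piM n (e : rel 'I_n) s s' t t' :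
  EGab_pi e s = EGab_pi e s' -> EGab_pi e t = EGab_pi e t' ->
  EGab_pi e (NMul s t) = EGab_pi e (NMul s' t').
Proof.
move=> /EGab_piP ss /EGab_piP tt; apply/EGab_piP.
(* Uses [s t - s' t' = (s - s') t + s' (t - t')], with restricted multipliers so that they lie in
   the subalgebra. *)
have h1 := zero_EGabM (s := NConst _ 1) isT (restrict_over (is_edge e) t) ss.
have h2 := zero_EGabM (t := NConst _ 1) (restrict_over (is_edge e) s') isT tt.
apply: zero_EGab_ext (zero_EGabD h1 h2) => B x _ /=.
rewrite !ncev_restrict !scaleN1r !mulN1r scale1r mul1r mulr1.
by rewrite mulrBl mulrBr addrA subrK.
Qed.

Definition EGab_add n (e : rel 'I_n) (x y : EGab e) : EGab e :=
  EGab_pi e (NAdd (repr x) (repr y)).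
Definition EGab_mul n (e : rel 'I_n) (x y : EGab e) : EGab e :=
  EGab_pi e (NMul (repr x) (repr y)).
Definition EGab_scale n (e : rel 'I_n) (k : rat) (x : EGab e) : EGab e :=
  EGab_pi e (NMul (NConst _ k) (repr x)).

Lemma EGab_addE n (e : rel 'I_n) s t :
  EGab_add (EGab_pi e s) (EGab_pi e t) = EGab_pi e (NAdd s t).
Proof. by apply: EGab_piD; apply: reprK. Qed.

Lemma EGab_mulE n (e : rel 'I_n) s t :
  EGab_mul (EGab_pi e s) (EGab_pi e t) = EGab_pi e (NMul s t).
Proof. by apply: EGab_piM; apply: reprK. Qed.

Lemma EGab_scaleE n (e : rel 'I_n) k t :
  EGab_scale k (EGab_pi e t) = EGab_pi e (NMul (NConst _ k) t).
Proof. by apply: EGab_piM => //; apply: reprK. Qed.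

Definition EGabE n (e : rel 'I_n) := (@EGab_addE n e, @EGab_mulE n e, @EGab_scaleE n e).

Definition EGab_opp n (e : rel 'I_n) (x : EGab e) : EGab e := EGab_scale (-1) x.

Fact EGab_addA n (e : rel 'I_n) : associative (@EGab_add n e).
Proof.
elim/EGab_piW => x; elim/EGab_piW => y; elim/EGab_piW => z; rewrite !EGabE.
by apply: EGab_pi_ext => B u /=; rewrite addrA.
Qed.

Fact EGab_addC n (e : rel 'I_n) : commutative (@EGab_add n e).
Proof.
elim/EGab_piW => x; elim/EGab_piW => y; rewrite !EGabE.
by apply: EGab_pi_ext => B u /=; rewrite addrC.
Qed.

Fact EGab_add0 n (e : rel 'I_n) : left_id (EGab_pi e (NConst _ 0)) (@EGab_add n e).
Proof.
elim/EGab_piW => x; rewrite !EGabE.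
by apply: EGab_pi_ext => B u /=; rewrite scale0r add0r.
Qed.

Fact EGab_addN n (e : rel 'I_n) :
  left_inverse (EGab_pi e (NConst _ 0)) (@EGab_opp n e) (@EGab_add n e).
Proof.
elim/EGab_piW => x; rewrite /EGab_opp !EGabE.
by apply: EGab_pi_ext => B u /=; rewrite scale0r scaleN1r mulN1r addNr.
Qed.

HB.instance Definition _ n (e : rel 'I_n) := GRing.isZmodule.Build (EGab e)
  (@EGab_addA n e) (@EGab_addC n e) (@EGab_add0 n e) (@EGab_addN n e).

Fact EGab_mulA n (e : rel 'I_n) : associative (@EGab_mul n e).
Proof.
elim/EGab_piW => x; elim/EGab_piW => y; elim/EGab_piW => z; rewrite !EGabE.
by apply: EGab_pi_ext => B u /=; rewrite mulrA.
Qed.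

Fact EGab_mulC n (e : rel 'I_n) : commutative (@EGab_mul n e).
Proof.
elim/EGab_piW => x; elim/EGab_piW => y; rewrite !EGabE; apply/EGab_piP.
exact: zero_EGabC (restrict_over _ x) (restrict_over _ y).
Qed.

Fact EGab_mul1 n (e : rel 'I_n) : left_id (EGab_pi e (NConst _ 1)) (@EGab_mul n e).
Proof.
elim/EGab_piW => x; rewrite !EGabE.
by apply: EGab_pi_ext => B u /=; rewrite scale1r mul1r.
Qed.

Fact EGab_mulDl n (e : rel 'I_n) : left_distributive (@EGab_mul n e) (@EGab_add n e).
Proof.
elim/EGab_piW => x; elim/EGab_piW => y; elim/EGab_piW => z; rewrite !EGabE.
by apply: EGab_pi_ext => B u /=; rewrite mulrDl.
Qed.

Fact EGab_one_neq0 n (e : rel 'I_n) : EGab_pi e (NConst _ 1) != EGab_pi e (NConst _ 0).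
Proof.
apply/eqP => /EGab_piP /zero_EGab_comm - /(_ _ _ (FK_zero n)) /eqP.
by rewrite ncev_restrict ncev_sub /= scale1r scale0r subr0 oner_eq0.
Qed.

HB.instance Definition _ n (e : rel 'I_n) := GRing.Zmodule_isComNzRing.Build (EGab e)
  (@EGab_mulA n e) (@EGab_mulC n e) (@EGab_mul1 n e) (@EGab_mulDl n e)
  (@EGab_one_neq0 n e).

Fact EGab_scaleA n (e : rel 'I_n) (a b : rat) (x : EGab e) :
  EGab_scale a (EGab_scale b x) = EGab_scale (a * b) x.
Proof.
elim/EGab_piW: x => x; rewrite !EGabE.
by apply: EGab_pi_ext => B u /=; rewrite !mulr_algl scalerA.
Qed.

Fact EGab_scale1 n (e : rel 'I_n) : left_id 1 (@EGab_scale n e).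
Proof.
elim/EGab_piW => x; rewrite !EGabE.
by apply: EGab_pi_ext => B u /=; rewrite !mulr_algl scale1r.
Qed.

Fact EGab_scaleDr n (e : rel 'I_n) : right_distributive (@EGab_scale n e) +%R.
Proof.
move=> k; elim/EGab_piW => x; elim/EGab_piW => y.
rewrite -[LHS]/(EGab_scale k (EGab_add _ _)) -[RHS]/(EGab_add _ _) !EGabE.
by apply: EGab_pi_ext => B u /=; rewrite mulrDr.
Qed.

Fact EGab_scaleDl n (e : rel 'I_n) (x : EGab e) :
  {morph (@EGab_scale n e)^~ x : a b / a + b}.
Proof.
move=> a b; elim/EGab_piW: x => x.
rewrite -[RHS]/(EGab_add _ _) !EGabE.
by apply: EGab_pi_ext => B u /=; rewrite scalerDl mulrDl.
Qed.

HB.instance Definition _ n (e : rel 'I_n) := GRing.Zmodule_isLmodule.Build rat (EGab e)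
  (@EGab_scaleA n e) (@EGab_scale1 n e) (@EGab_scaleDr n e) (@EGab_scaleDl n e).

Fact EGab_scaleAl n (e : rel 'I_n) (k : rat) (x y : EGab e) :
  EGab_scale k (EGab_mul x y) = EGab_mul (EGab_scale k x) y.
Proof.
elim/EGab_piW: x => x; elim/EGab_piW: y => y; rewrite !EGabE.
by apply: EGab_pi_ext => B u /=; rewrite mulrA.
Qed.

HB.instance Definition _ n (e : rel 'I_n) :=
  GRing.Lmodule_isLalgebra.Build rat (EGab e) (@EGab_scaleAl n e).
HB.instance Definition _ n (e : rel 'I_n) :=
  GRing.Lalgebra_isComAlgebra.Build rat (EGab e).

Definition EGab_gen n (e : rel 'I_n) (p : pair_t n) : EGab e := EGab_pi e (NVar p).

Lemma ncev_EGab n (e : rel 'I_n) t : ncev (EGab_gen e) t = EGab_pi e t.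
Proof.
elim: t => //= [c|s -> t ->|s -> t ->].
- rewrite -[LHS]/(EGab_scale c (EGab_pi e _)) EGabE.
  by apply: EGab_pi_ext => B u /=; rewrite scale1r mulr1.
- exact: EGab_addE.
- exact: EGab_mulE.
Qed.

(** Turns the existence of a commutator expression into an equation in a commutative algebra, to
    which [zero_in_UG] can be applied. *)
Lemma ncev_EGab_eq0 n (e : rel 'I_n) t : term_over (is_edge e) t ->
  ncev (EGab_gen e) t = 0 <-> zero_in_EGab e t.
Proof.
move=> ot; rewrite ncev_EGab -[0]/(EGab_pi e (NConst _ 0)) EGab_piP.
rewrite /= restrict_id //.
by split; apply: zero_EGab_ext => B x _; rewrite /= scale0r mulr0 addr0.
Qed.

(** * Orlik-Terao relations in the commutative quotient *)

Lemma is_edge_uedge n (e : rel 'I_n) (p q : pair_t n) :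
  symmetric e -> uedge p = uedge q -> is_edge e q -> is_edge e p.
Proof. by move=> e_sym /uedgeP[->|->] //; rewrite /is_edge /= e_sym. Qed.

Lemma uedge_gen n (e : rel 'I_n) (A : comAlgType rat) (u : pair_t n -> A)
    (p q : pair_t n) :
  (forall i j, e i j -> u (j, i) = - u (i, j)) ->
  uedge p = uedge q -> is_edge e q -> exists k, u p = k * u q.
Proof.
move=> anti /uedgeP[->|->] eq; first by exists 1; rewrite mul1r.
by exists (-1); rewrite anti // -surjective_pairing mulN1r.
Qed.

(** Each edge of [L] is matched with a factor of [s] equal to it up to sign, which is removed;
    distinctness keeps the later matches available. *)
Lemma prod_uedge_factor n (e : rel 'I_n) (A : comAlgType rat) (u : pair_t n -> A)
    (L s : seq (pair_t n)) :
  (forall i j, e i j -> u (j, i) = - u (i, j)) -> all (is_edge e) L ->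
  uniq (map (@uedge n) L) -> {subset map (@uedge n) L <= map (@uedge n) s} ->
  exists k, \prod_(p <- s) u p = k * \prod_(p <- L) u p.
Proof.
move=> anti; elim: L s => [|p L IH] s /=.
  by move=> *; exists (\prod_(p <- s) u p); rewrite big_nil mulr1.
case/andP => ep eL /andP[pL uL] sub.
have /mapP[q qs pq] : uedge p \in map (@uedge n) s by apply/sub/mem_head.
have [k kE] := uedge_gen anti (esym pq) ep.
have [|k' k'E] := IH (rem q s) eL uL.
  move=> v vL; have /mapP[q' q's vE] : v \in map (@uedge n) s.
    by apply: sub; rewrite inE vL orbT.
  apply/mapP; exists q' => //; apply: rem_mem => //.
  by apply: contraNneq pL => qq; rewrite pq -qq -vE.
exists (k * k'); rewrite (big_rem q) //= kE k'E big_cons; ring.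
Qed.

Lemma prod_not_uniq n (e : rel 'I_n) (A : comAlgType rat) (u : pair_t n -> A)
    (s : seq (pair_t n)) :
  (forall i j, e i j -> u (j, i) = - u (i, j)) ->
  (forall i j, e i j -> u (i, j) * u (i, j) = 0) -> all (is_edge e) s ->
  ~~ uniq (map (@uedge n) s) -> \prod_(p <- s) u p = 0.
Proof.
move=> anti sq; elim: s => //= p s IH /andP[ep es]; rewrite big_cons negb_and.
case/orP => [|/IH->//]; last by rewrite mulr0.
rewrite negbK => /mapP[q qs pq].
have [k kE] := uedge_gen anti (esym pq) ep.
rewrite (big_rem q) //= kE; set R := \prod_(_ <- _) _.
have -> : u p * (k * u p * R) = k * R * (u p * u p) by ring.
by case: (p) ep => i j /sq ->; rewrite mulr0.
Qed.

(** The bound on [size t] excludes 2-cycles, whose closing step is the first step reversed. *)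
Lemma uniq_uedge_cycle n (a : 'I_n) (t : seq 'I_n) :
  uniq (a :: t) -> (1 < size t)%N ->
  uniq (map (@uedge n) (steps a (rcons t a))).
Proof.
move=> uat st; rewrite steps_rcons map_rcons rcons_uniq uniq_uedge_steps // andbT.
have /andP[anot ut] := uat.
apply/mapP => -[z zs]; have [z1 z2] := mem_steps zs.
case/uedgeP => zE; first by rewrite -zE (negPf anot) in z2.
have {}zE : z = (a, last a t) by case: (z) zE => v w [-> ->].
case: t {uat z1 z2} st anot ut zE zs => // b [//|c t] _.
rewrite inE negb_or => /andP[ab abt] /andP[bt _] ->.
rewrite /steps /= inE => /predU1P[[lb]|].
  by rewrite -lb mem_last in bt.
rewrite inE => /predU1P[[ab' _]|]; first by rewrite ab' eqxx in ab.
by case/mem_steps => /mem_belast /=; rewrite (negPf abt).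
Qed.

Lemma delta_dependent n (I : finType) (c : I -> rat) (p : I -> pair_t n) :
  \sum_t c t *: (delta_mx 0 (p t).1 - delta_mx 0 (p t).2 : 'rV[rat]_n) = 0 <->
  dependent c p.
Proof.
split=> [dep chi|dep].
  have /(congr1 (fun r => (r *m \col_v chi v) 0 0)) := dep.
  rewrite mul0mx mulmx_suml summxE [RHS]mxE => dep0; rewrite -[RHS]dep0; apply: eq_bigr => t _.
  by rewrite -scalemxAl mulmxBl -!rowE !mxE.
apply/rowP => v; rewrite mxE summxE -[RHS](dep (fun w => (w == v)%:R)).
by apply: eq_bigr => t _; rewrite !mxE !eqxx !(eq_sym v).
Qed.

Lemma cycle_rels_OT n (e : rel 'I_n) (A : comAlgType rat) (u : pair_t n -> A) :
  symmetric e -> irreflexive e ->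
  (forall i j, e i j -> u (j, i) = - u (i, j)) ->
  (forall i j, e i j -> u (i, j) * u (i, j) = 0) -> cycle_rels e u -> OT_rel e u.
Proof.
move=> e_sym e_irr anti sq cyc; split=> //.
  move=> s es [nu|[c]]; first exact: prod_not_uniq anti sq es nu.
  case: c => [[]//|a t [sz uat ct]].
  have eL : all (is_edge e) (steps a (rcons t a)).
    apply/allP => p pL; have /= /mapP[q qs] := path_steps ct pL.
    rewrite -surjective_pairing => pq.
    by apply: is_edge_uedge pq _ => //; apply: (allP es).
  have t0 : t != [::] by case: (t) sz.
  have [|k ->] := prod_uedge_factor anti eL (uniq_uedge_cycle uat sz) (s := s).
    move=> v /mapP[p pL ->]; have := path_steps ct pL.
    by rewrite /= -surjective_pairing.
  move: eL; rewrite steps_rcons all_rcons big_rcons /= => /andP[ce eS].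
  have pe : path e a t.
    elim: (t) (a) eS => //= b t' IH a' /andP[h1 h2].
    by rewrite IH // andbT.
  (* Multiplying the cycle relation by the closing variable leaves the cycle monomial: every summand
     of the sum then contains that variable twice. *)
  have := cyc a t uat t0 pe ce => /(congr1 ( *%R^~ (u (last a t, a)))).
  rewrite mul0r mulrDl mulr_suml [X in _ + X]big1 ?addr0 => [->|i _]; first by rewrite mulr0.
  by rewrite mulrAC -[X in X * _]mulrA sq // mulr0 mul0r.
move=> k c p pe /delta_dependent dep.
by have := dep_rels e_sym e_irr anti cyc pe dep; rewrite prod_deform.
Qed.

(** The hypotheses of [cycle_rels_OT] are identities of the Fomin-Kirillov algebra between
    expressions in edge variables, so they pass to the quotient. *)
Lemma EGab_OT n (e : rel 'I_n) : symmetric e -> irreflexive e ->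
  OT_rel e (EGab_gen e).
Proof.
move=> e_sym e_irr.
have zero t : term_over (is_edge e) t ->
    (forall (B : algType rat) (x : pair_t n -> B), FK_rel x -> ncev x t = 0) ->
    ncev (EGab_gen e) t = 0.
  by move=> ot t0; apply/ncev_EGab_eq0 => //; apply: zero_EGab0.
have neq i j : e i j -> i != j by apply: contraTneq => ->; rewrite e_irr.
apply: cycle_rels_OT => //.
- move=> i j eij; apply/eqP; rewrite -addr_eq0; apply/eqP.
  apply: (zero (NAdd (NVar (j, i)) (NVar (i, j)))).
    by rewrite /= /is_edge /= e_sym eij.
  by move=> B x [_ anti _ _ _]; rewrite /= anti ?addNr // neq.
- move=> i j eij; apply: (zero (NMul (NVar (i, j)) (NVar (i, j)))).
    by rewrite /= /is_edge /= eij.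
  by move=> B x [_ _ sq _ _]; apply/sq/neq.
move=> a t uat t0 pe ce.
(* The cycle relation is rewritten as an expression [T] so that [zero] applies; the coefficients 1
   are fillers that [prod_term] ignores. *)
pose P (s : seq (pair_t n)) := prod_term (map (pair (1 : rat)) s).
have evP (B : algType rat) (x : pair_t n -> B) s :
    ncev x (P s) = \prod_(p <- s) x p.
  by rewrite ncev_prod_term big_map.
have oP s : {subset s <= steps a t} -> term_over (is_edge e) (P s).
  elim: s => //= p s IH sub; rewrite IH ?andbT.
    by apply: (path_steps pe); apply: sub; rewrite mem_head.
  by move=> q qs; apply: sub; rewrite inE qs orbT.
pose Q i := NMul (NMul (P (drop i.+1 (steps a t))) (NVar (last a t, a)))
  (P (take i (steps a t))).
pose T := NAdd (P (steps a t)) (foldr (fun i => NAdd (Q i)) (NConst _ 0) (iota 0 (size t))).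
have evT (B : algType rat) (x : pair_t n -> B) : ncev x T =
    \prod_(p <- steps a t) x p +
    \sum_(i < size t) (\prod_(p <- drop i.+1 (steps a t)) x p) * x (last a t, a) *
      \prod_(p <- take i (steps a t)) x p.
  rewrite /= evP; congr (_ + _).
  rewrite -(big_mkord xpredT (fun i => (\prod_(p <- drop i.+1 (steps a t)) x p) *
    x (last a t, a) * \prod_(p <- take i (steps a t)) x p)) /index_iota subn0.
  elim: (iota 0 _) => [|i r IH] /=; first by rewrite big_nil scale0r.
  by rewrite big_cons IH !evP.
rewrite -evT; apply: zero => [|B x FKx]; last by rewrite evT FK_cycle.
rewrite /= oP //=; elim: (iota 0 _) => //= i r ->; rewrite andbT.
by rewrite !oP ?andbT // => p; [exact: mem_take | exact: mem_drop].
Qed.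

(** * Comparison of the two kernels *)

Lemma OT_dep_ideal n (e : rel 'I_n) (E : seq (pair_t n)) (A : comAlgType rat)
    (u : pair_t n -> A) f :
  {in E, forall p, is_edge e p} -> OT_rel e u -> dep_ideal E id f -> ncev u f = 0.
Proof.
move=> Ee [_ mono dep]; apply: dep_ideal_sound => [p pE|l lE dl].
  have := mono [:: p; p]; rewrite /= !Ee // !big_cons big_nil mulr1; apply=> //.
  by left; rewrite inE eqxx.
rewrite big_tnth prod_deform; apply: dep => [t|].
  exact/Ee/(allP lE)/mem_tnth.
by apply/delta_dependent => chi; have := dl chi; rewrite big_tnth.
Qed.

(* The map x_ij |-> u_ij induces an isomorphism E_G^ab ~= U_G: both algebras
   are quotients of the free algebra on the edge symbols (via x_ij resp. u_ij),
   and the induced isomorphism exists iff the two kernels coincide. *)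
Theorem theorem2p8 (n : nat) (e : rel 'I_n)
    (e_sym : symmetric e) (e_irr : irreflexive e)
    (f : ncterm (pair_t n)) (f_edges : term_over (is_edge e) f) :
  zero_in_EGab e f <-> zero_in_UG e f.
Proof.
(* From right to left, [f] is evaluated in [EGab] itself. From left to right, [f] vanishes in all
   commutative Fomin-Kirillov models, so completeness with [phi = id] puts it in the ideal. *)
split=> [f0 A u OTu|f0]; last by apply/ncev_EGab_eq0 => //; apply/f0/EGab_OT.
pose E : seq (pair_t n) := [seq p <- enum {: 'I_n * 'I_n} | is_edge e p].
have inE' p : (p \in E) = is_edge e p by rewrite mem_filter mem_enum andbT.
apply: (OT_dep_ideal (E := E)) OTu _ => [p|]; first by rewrite inE'.
apply: dep_ideal_complete => [p||B y FKy].
- by rewrite inE' /is_edge; apply: contraTneq => ->; rewrite e_irr.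
- by apply: term_over_sub f_edges => p; rewrite inE'.
apply: zero_EGab_comm f0 _; case: FKy => *; split=> *; rewrite /contract_eval /=; auto.
Qed.
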